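(* Let $(F:\mathcal{C}\to\mathcal{D},\,G:\mathcal{D}\to\mathcal{C})$ be an adjunction ($F$ left adjoint to $G$) with unit $\eta$ and counit $\epsilon$. Then $F$ is semiseparable if and only if the forgetful functor $U^{FG}:\mathcal{D}^{FG}\to\mathcal{D}$ is separable (equivalently, the comonad $(FG,F\eta G,\epsilon)$ is coseparable) and the cocomparison functor $K^{FG}:\mathcal{C}\to\mathcal{D}^{FG}$ is naturally full.
   Context: For a functor $F:\mathcal{C}\to\mathcal{D}$ let $\mathcal{F}^F:\mathrm{Hom}_{\mathcal{C}}(-,-)\to\mathrm{Hom}_{\mathcal{D}}(F-,F-)$ be the natural transformation (of functors $\mathcal{C}^{\mathrm{op}}\times\mathcal{C}\to\mathsf{Set}$) with $\mathcal{F}^F_{X,Y}(f)=F(f)$. $F$ is separable if there is a natural transformation $\mathcal{P}^F:\mathrm{Hom}_{\mathcal{D}}(F-,F-)\to\mathrm{Hom}_{\mathcal{C}}(-,-)$ with $\mathcal{P}^F\circ\mathcal{F}^F=\mathrm{Id}$; naturally full if there is such a $\mathcal{P}^F$ with $\mathcal{F}^F\circ\mathcal{P}^F=\mathrm{Id}$; semiseparable if there is such a $\mathcal{P}^F$ with $\mathcal{F}^F\circ\mathcal{P}^F\circ\mathcal{F}^F=\mathcal{F}^F$. $\mathcal{D}^{FG}$ is the Eilenberg–Moore category of comodules (coalgebras) over the comonad $(FG,F\eta G,\epsilon)$ on $\mathcal{D}$, $U^{FG}$ its forgetful functor, and $K^{FG}:\mathcal{C}\to\mathcal{D}^{FG}$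 is the cocomparison functor $C\mapsto(FC,F\eta_C)$, $f\mapsto F(f)$. A comonad $(\bot,\Delta:\bot\to\bot\bot,\epsilon:\bot\to\mathrm{Id})$ is coseparable if there is a natural transformation $\tau:\bot\bot\to\bot$ with $\tau\circ\Delta=\mathrm{Id}_{\bot}$ and $\bot\tau\circ\Delta\bot=\Delta\circ\tau=\tau\bot\circ\bot\Delta$. *)

(* Defs.v *)
From Stdlib Require Import FunctionalExtensionality ProofIrrelevance.

Set Implicit Arguments.
Unset Strict Implicit.
Unset Printing Implicit Defensive.

Declare Scope cat_scope.
Delimit Scope cat_scope with cat.
Local Open Scope cat_scope.

(* Hom-sets are types compared with Leibniz equality.  The hom-functors into
   [TypeCat] below force the universe of morphisms to be strictly below that of
   objects, so categories are locally small (with respect to an arbitrary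
   universe), and nothing else is required of their size. *)
Record Category := {
  ob :> Type;
  hom : ob -> ob -> Type;
  idm : forall X, hom X X;
  comp : forall X Y Z, hom Y Z -> hom X Y -> hom X Z;
  comp_idl : forall X Y (f : hom X Y), comp (idm Y) f = f;
  comp_idr : forall X Y (f : hom X Y), comp f (idm X) = f;
  comp_assoc : forall W X Y Z (f : hom Y Z) (g : hom X Y) (h : hom W X),
    comp f (comp g h) = comp (comp f g) h
}.

Arguments hom {c} X Y.
Arguments idm {c} X.
Arguments comp {c X Y Z} g f : rename.

Notation "g ∘ f" := (comp g f) (at level 40, left associativity) : cat_scope.

Record Functor (C D : Category) := {
  fob :> C -> D;
  fmap : forall X Y : C, hom X Y -> hom (fob X) (fob Y);
  fmap_id : forall X, fmap (idm X) = idm (fob X);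
  fmap_comp : forall X Y Z (g : hom Y Z) (f : hom X Y),
    fmap (g ∘ f) = fmap g ∘ fmap f
}.

Arguments fmap {C D} F {X Y} f : rename.

Record NatTrans (C D : Category) (F G : Functor C D) := {
  nt :> forall X : C, hom (F X) (G X);
  naturality : forall (X Y : C) (f : hom X Y), nt Y ∘ fmap F f = fmap G f ∘ nt X
}.

Lemma nat_trans_ext (C D : Category) (F G : Functor C D) (a b : NatTrans F G) :
  (forall X, a X = b X) -> a = b.
Proof.
destruct a as [a na], b as [b nb]; simpl; intros e.
assert (ab : a = b) by (apply functional_extensionality_dep; exact e).
subst b; f_equal; apply proof_irrelevance.
Qed.

Definition nt_id (C D : Category) (F : Functor C D) : NatTrans F F.
Proof.
refine {| nt := fun X => idm (F X) |}.
abstract (intros; rewrite comp_idl, comp_idr; reflexivity).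
Defined.

Definition nt_comp (C D : Category) (F G H : Functor C D)
  (b : NatTrans G H) (a : NatTrans F G) : NatTrans F H.
Proof.
refine {| nt := fun X => b X ∘ a X |}.
abstract (intros; rewrite <- comp_assoc, naturality, comp_assoc, naturality,
            comp_assoc; reflexivity).
Defined.

Definition functor_id (C : Category) : Functor C C.
Proof.
refine {| fob := fun X : C => X; fmap := fun X Y f => f |};
  abstract reflexivity.
Defined.

Definition functor_comp (C D E : Category) (G : Functor D E) (F : Functor C D) :
  Functor C E.
Proof.
refine {| fob := fun X : C => G (F X); fmap := fun X Y f => fmap G (fmap F f) |}.
- abstract (intros; rewrite !fmap_id; reflexivity).
- abstract (intros; rewrite !fmap_comp; reflexivity).
Defined.

Definition op (C : Category) : Category.
Proof.
refine {| ob := C; hom := fun X Y => @hom C Y X; idm := fun X => @idm C X;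
          comp := fun X Y Z g f => @comp C Z Y X f g |}.
- abstract (intros; apply comp_idr).
- abstract (intros; apply comp_idl).
- abstract (intros; symmetry; apply comp_assoc).
Defined.

Definition prod_cat (C D : Category) : Category.
Proof.
refine {| ob := (C * D)%type;
          hom := fun X Y => (@hom C (fst X) (fst Y) * @hom D (snd X) (snd Y))%type;
          idm := fun X => (idm (fst X), idm (snd X));
          comp := fun X Y Z g f => (fst g ∘ fst f, snd g ∘ snd f) |}.
- abstract (intros X Y [f g]; simpl; rewrite !comp_idl; reflexivity).
- abstract (intros X Y [f g]; simpl; rewrite !comp_idr; reflexivity).
- abstract (intros; simpl; rewrite !comp_assoc; reflexivity).
Defined.

Definition op_functor (C D : Category) (F : Functor C D) : Functor (op C) (op D).
Proof.
refine (@Build_Functor (op C) (op D) (@fob C D F)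
          (fun X Y f => @fmap C D F Y X f) _ _).
- abstract (exact (fmap_id F)).
- abstract (exact (fun X Y Z g f => @fmap_comp C D F Z Y X f g)).
Defined.

Definition prod_functor (C D C' D' : Category)
  (F : Functor C D) (F' : Functor C' D') :
  Functor (prod_cat C C') (prod_cat D D').
Proof.
refine (@Build_Functor (prod_cat C C') (prod_cat D D')
          (fun X => (F (fst X), F' (snd X)))
          (fun X Y f => (fmap F (fst f), fmap F' (snd f))) _ _).
- abstract (intros; simpl; rewrite !fmap_id; reflexivity).
- abstract (intros; simpl; rewrite !fmap_comp; reflexivity).
Defined.

(* Types and functions, playing the role of the category of sets. *)
Definition TypeCat : Category.
Proof.
refine {| ob := Type; hom := fun A B => A -> B; idm := fun A a => a;
          comp := fun A B C g f a => g (f a) |}; abstract reflexivity.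
Defined.

Definition hom_functor (C : Category) : Functor (prod_cat (op C) C) TypeCat.
Proof.
refine (@Build_Functor (prod_cat (op C) C) TypeCat
          (fun X => @hom C (fst X) (snd X))
          (fun X Y f h => @comp C _ _ _ (@comp C _ _ _ (snd f) h) (fst f)) _ _).
- abstract (intros; apply functional_extensionality; intros h; simpl;
            rewrite comp_idl, comp_idr; reflexivity).
- abstract (intros; apply functional_extensionality; intros h; simpl;
            rewrite !comp_assoc; reflexivity).
Defined.

(* Hom_D(F-, F-) *)
Definition hom_functor_along (C D : Category) (F : Functor C D) :
  Functor (prod_cat (op C) C) TypeCat :=
  functor_comp (hom_functor D) (prod_functor (op_functor F) F).

Definition hom_map (C D : Category) (F : Functor C D) :
  NatTrans (hom_functor C) (hom_functor_along F).
Proof.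
refine (@Build_NatTrans _ _ (hom_functor C) (hom_functor_along F)
          (fun X (f : @hom C (fst X) (snd X)) => fmap F f) _).
abstract (intros; apply functional_extensionality; intros h; simpl;
          rewrite !fmap_comp; reflexivity).
Defined.

Definition separable (C D : Category) (F : Functor C D) : Prop :=
  exists P : NatTrans (hom_functor_along F) (hom_functor C),
    nt_comp P (hom_map F) = nt_id (hom_functor C).

Definition naturally_full (C D : Category) (F : Functor C D) : Prop :=
  exists P : NatTrans (hom_functor_along F) (hom_functor C),
    nt_comp (hom_map F) P = nt_id (hom_functor_along F).

Definition semiseparable (C D : Category) (F : Functor C D) : Prop :=
  exists P : NatTrans (hom_functor_along F) (hom_functor C),
    nt_comp (nt_comp (hom_map F) P) (hom_map F) = hom_map F.

(* [Adjunction F G]: F is left adjoint to G. *)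
Record Adjunction (C D : Category) (F : Functor C D) (G : Functor D C) := {
  adj_unit : NatTrans (functor_id C) (functor_comp G F);
  adj_counit : NatTrans (functor_comp F G) (functor_id D);
  triangle_left : forall X : C, adj_counit (F X) ∘ fmap F (adj_unit X) = idm (F X);
  triangle_right : forall Y : D, fmap G (adj_counit Y) ∘ adj_unit (G Y) = idm (G Y)
}.

(* The axioms of comonads and coseparability equate natural transformations
   between threefold composites of the endofunctor.  They are stated on
   components, because the two bracketings of such a composite are not
   convertible. *)
Record Comonad (D : Category) := {
  cm_functor :> Functor D D;
  comult : NatTrans cm_functor (functor_comp cm_functor cm_functor);
  cm_counit : NatTrans cm_functor (functor_id D);
  comult_coassoc : forall X : D,
    fmap cm_functor (comult X) ∘ comult X = comult (cm_functor X) ∘ comult X;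
  comult_counitl : forall X : D,
    cm_counit (cm_functor X) ∘ comult X = idm (cm_functor X);
  comult_counitr : forall X : D,
    fmap cm_functor (cm_counit X) ∘ comult X = idm (cm_functor X)
}.

Arguments comult {D} T : rename.
Arguments cm_counit {D} T : rename.

Definition coseparable (D : Category) (T : Comonad D) : Prop :=
  exists tau : NatTrans (functor_comp T T) T,
    (forall X : D, tau X ∘ comult T X = idm (T X)) /\
    (forall X : D,
       fmap T (tau X) ∘ comult T (T X) = comult T X ∘ tau X) /\
    (forall X : D,
       comult T X ∘ tau X = tau (T X) ∘ fmap T (comult T X)).

Record Coalgebra (D : Category) (T : Comonad D) := {
  carrier :> D;
  coaction : hom carrier (T carrier);
  coaction_counit : cm_counit T carrier ∘ coaction = idm carrier;
  coaction_coassoc :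
    comult T carrier ∘ coaction = fmap T coaction ∘ coaction
}.

Record CoalgebraHom (D : Category) (T : Comonad D) (A B : Coalgebra T) := {
  coalg_map :> hom (carrier A) (carrier B);
  coalg_map_compat : fmap T coalg_map ∘ coaction A = coaction B ∘ coalg_map
}.

Lemma coalgebra_hom_ext (D : Category) (T : Comonad D) (A B : Coalgebra T)
  (f g : CoalgebraHom A B) : coalg_map f = coalg_map g -> f = g.
Proof.
destruct f as [f hf], g as [g hg]; simpl; intros e.
subst g; f_equal; apply proof_irrelevance.
Qed.

Definition coalgebra_id (D : Category) (T : Comonad D) (A : Coalgebra T) :
  CoalgebraHom A A.
Proof.
refine {| coalg_map := idm (carrier A) |}.
abstract (rewrite fmap_id, comp_idl, comp_idr; reflexivity).
Defined.

Definition coalgebra_comp (D : Category) (T : Comonad D) (A B E : Coalgebra T)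
  (g : CoalgebraHom B E) (f : CoalgebraHom A B) : CoalgebraHom A E.
Proof.
refine {| coalg_map := coalg_map g ∘ coalg_map f |}.
abstract (rewrite fmap_comp, <- comp_assoc, coalg_map_compat, comp_assoc,
            coalg_map_compat, comp_assoc; reflexivity).
Defined.

Definition coalgebra_cat (D : Category) (T : Comonad D) : Category.
Proof.
refine {| ob := Coalgebra T; hom := @CoalgebraHom D T;
          idm := @coalgebra_id D T; comp := @coalgebra_comp D T |}.
- abstract (intros; apply coalgebra_hom_ext; apply comp_idl).
- abstract (intros; apply coalgebra_hom_ext; apply comp_idr).
- abstract (intros; apply coalgebra_hom_ext; apply comp_assoc).
Defined.

Definition forgetful (D : Category) (T : Comonad D) :
  Functor (coalgebra_cat T) D.
Proof.
refine (@Build_Functor (coalgebra_cat T) D (@carrier D T)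
          (fun A B => @coalg_map D T A B) _ _); abstract reflexivity.
Defined.

Section AdjunctionComonad.

Variables (C D : Category) (F : Functor C D) (G : Functor D C).
Variable adj : Adjunction F G.

Definition adj_comult :
  NatTrans (functor_comp F G)
           (functor_comp (functor_comp F G) (functor_comp F G)).
Proof.
refine (@Build_NatTrans _ _ (functor_comp F G)
          (functor_comp (functor_comp F G) (functor_comp F G))
          (fun Y : D => fmap F (adj_unit adj (G Y))) _).
abstract (intros X Y f; simpl; rewrite <- !fmap_comp; f_equal;
          exact (naturality (adj_unit adj) (fmap G f))).
Defined.

Definition adj_comonad : Comonad D.
Proof.
refine {| cm_functor := functor_comp F G; comult := adj_comult;
          cm_counit := adj_counit adj |}.
- abstract (intros X; simpl; rewrite <- !fmap_comp; f_equal;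
            symmetry; exact (naturality (adj_unit adj) (adj_unit adj (G X)))).
- abstract (intros X; simpl; apply triangle_left).
- abstract (intros X; simpl; rewrite <- fmap_comp, <- fmap_id; f_equal;
            exact (triangle_right adj X)).
Defined.

Definition cocomparison_ob (X : C) : Coalgebra adj_comonad.
Proof.
refine {| carrier := F X : D; coaction := fmap F (adj_unit adj X)
            : hom (F X) (adj_comonad (F X)) |}.
- abstract apply triangle_left.
- abstract (simpl; rewrite <- !fmap_comp; f_equal;
            exact (naturality (adj_unit adj) (adj_unit adj X))).
Defined.

Definition cocomparison_map (X Y : C) (f : hom X Y) :
  CoalgebraHom (cocomparison_ob X) (cocomparison_ob Y).
Proof.
refine (@Build_CoalgebraHom _ _ (cocomparison_ob X) (cocomparison_ob Y)
          (fmap F f) _).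
abstract (simpl; rewrite <- !fmap_comp; f_equal; symmetry;
          exact (naturality (adj_unit adj) f)).
Defined.

Definition cocomparison : Functor C (coalgebra_cat adj_comonad).
Proof.
refine (@Build_Functor C (coalgebra_cat adj_comonad)
          cocomparison_ob cocomparison_map _ _).
- abstract (intros; apply coalgebra_hom_ext; apply fmap_id).
- abstract (intros; apply coalgebra_hom_ext; apply fmap_comp).
Defined.

End AdjunctionComonad.

(* Main.v *)
From Stdlib Require Import FunctionalExtensionality.
Require Import Defs.

(** The proof is Rafael-style.  If [P] witnesses semiseparability of [F], then
    [nu X := P (epsilon (F X)) : GFX -> X] satisfies [F (nu X ∘ eta X) = id].
    Hence [F (nu (G Y))] is a coseparability structure on [FG], and
    [P h = nu Y ∘ G h ∘ eta X] gives [F (P h) = h] as soon as [h] is a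
    coalgebra map [K X -> K Y].  Conversely [F = U K], and the sections for [U]
    and [K] compose.  For a comonad [T], a section [P] for the forgetful functor
    and a coseparability structure [tau] yield each other via
    [tau X := P (epsilon (T X))] and
    [P f := epsilon B ∘ tau B ∘ T (b ∘ f) ∘ a]. *)

Local Open Scope cat_scope.

Set Implicit Arguments.
Unset Strict Implicit.
Unset Printing Implicit Defensive.

(** Composites are kept nested to the left, so an equation between two-step composites has to be
    usable beneath an arbitrary prefix [k]. *)
Lemma comp_assoc_eq (C : Category) (W X X' Y : C) (f : hom X Y) (g : hom W X)
    (f' : hom X' Y) (g' : hom W X') :
  f ∘ g = f' ∘ g' ->
  forall (Z : C) (k : hom Y Z), k ∘ f ∘ g = k ∘ f' ∘ g'.
Proof.
intros e Z k; rewrite <- !comp_assoc, e; reflexivity.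
Qed.

Lemma comp_assoc_idm (C : Category) (X Y : C) (f : hom X Y) (g : hom Y X) :
  f ∘ g = idm Y -> forall (Z : C) (k : hom Y Z), k ∘ f ∘ g = k.
Proof.
intros e Z k; rewrite <- comp_assoc, e, comp_idr; reflexivity.
Qed.

Lemma type_nat_trans_eq (C : Category) (F G : Functor C TypeCat)
    (a b : NatTrans F G) :
  a = b <->
  forall (X : C) (x : F X : Type), (a X : _ -> _) x = (b X : _ -> _) x.
Proof.
split; [intros ->; reflexivity|].
intros e; apply nat_trans_ext; intros X.
apply functional_extensionality; exact (e X).
Qed.

(** * Transformations of hom-functors as natural families of maps *)

Section HomRetractions.

Variables (C D : Category) (F : Functor C D).

(** Naturality in both variables at once, freed from the product category and from equality of
    functions. *)
Definition natural_along (P : forall X Y : C, hom (F X) (F Y) -> hom X Y) :=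
  forall (X X' Y Y' : C) (g : hom Y Y') (f : hom (F X) (F Y)) (h : hom X' X),
    P X' Y' (fmap F g ∘ f ∘ fmap F h) = g ∘ P X Y f ∘ h.

Lemma natural_along_l P (X Y Y' : C) (g : hom Y Y') (f : hom (F X) (F Y)) :
  natural_along P -> P X Y' (fmap F g ∘ f) = g ∘ P X Y f.
Proof.
intros nP; generalize (nP _ _ _ _ g f (idm X)).
rewrite fmap_id, !comp_idr; trivial.
Qed.

Lemma natural_along_r P (X X' Y : C) (f : hom (F X) (F Y)) (h : hom X' X) :
  natural_along P -> P X' Y (f ∘ fmap F h) = P X Y f ∘ h.
Proof.
intros nP; generalize (nP _ _ _ _ (idm Y) f h).
rewrite fmap_id, !comp_idl; trivial.
Qed.

Definition hom_family (P : NatTrans (hom_functor_along F) (hom_functor C)) :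
  forall X Y : C, hom (F X) (F Y) -> hom X Y :=
  fun X Y => P ((X, Y) : prod_cat (op C) C).

Lemma hom_family_natural P : natural_along (hom_family P).
Proof.
intros X X' Y Y' g f h.
exact (equal_f (@naturality _ _ _ _ P (X, Y) (X', Y') (h, g)) f).
Qed.

Lemma hom_nat_trans_subproof P (nP : natural_along P)
    (X Y : prod_cat (op C) C) (f : hom X Y) :
  @comp TypeCat _ _ _ (P (fst Y) (snd Y)) (fmap (hom_functor_along F) f) =
  @comp TypeCat _ _ _ (fmap (hom_functor C) f) (P (fst X) (snd X)).
Proof.
apply functional_extensionality; intros h; exact (nP _ _ _ _ (snd f) h (fst f)).
Qed.

Definition hom_nat_trans P (nP : natural_along P) :
  NatTrans (hom_functor_along F) (hom_functor C) :=
  @Build_NatTrans _ _ (hom_functor_along F) (hom_functor C)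
    (fun X => P (fst X) (snd X)) (hom_nat_trans_subproof nP).

Lemma separableE :
  separable F <->
  exists P, natural_along P /\
    forall (X Y : C) (f : hom X Y), P X Y (fmap F f) = f.
Proof.
split.
- intros [P e]; exists (hom_family P); split; [exact (hom_family_natural P)|].
  intros X Y f; exact (proj1 (type_nat_trans_eq _ _) e (X, Y) f).
- intros [P [nP e]]; exists (hom_nat_trans nP).
  apply type_nat_trans_eq; intros X f; exact (e _ _ f).
Qed.

Lemma naturally_fullE :
  naturally_full F <->
  exists P, natural_along P /\
    forall (X Y : C) (f : hom (F X) (F Y)), fmap F (P X Y f) = f.
Proof.
split.
- intros [P e]; exists (hom_family P); split; [exact (hom_family_natural P)|].
  intros X Y f; exact (proj1 (type_nat_trans_eq _ _) e (X, Y) f).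
- intros [P [nP e]]; exists (hom_nat_trans nP).
  apply type_nat_trans_eq; intros X f; exact (e _ _ f).
Qed.

Lemma semiseparableE :
  semiseparable F <->
  exists P, natural_along P /\
    forall (X Y : C) (f : hom X Y), fmap F (P X Y (fmap F f)) = fmap F f.
Proof.
split.
- intros [P e]; exists (hom_family P); split; [exact (hom_family_natural P)|].
  intros X Y f; exact (proj1 (type_nat_trans_eq _ _) e (X, Y) f).
- intros [P [nP e]]; exists (hom_nat_trans nP).
  apply type_nat_trans_eq; intros X f; exact (e _ _ f).
Qed.

End HomRetractions.

(** * Coseparable comonads and separable forgetful functors *)

Section Coseparability.

Variables (D : Category) (T : Comonad D).

Lemma comult_natural (X Y : D) (f : hom X Y) :
  comult T Y ∘ fmap T f = fmap T (fmap T f) ∘ comult T X.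
Proof. exact (naturality (comult T) f). Qed.

Lemma cm_counit_natural (X Y : D) (f : hom X Y) :
  cm_counit T Y ∘ fmap T f = f ∘ cm_counit T X.
Proof. exact (naturality (cm_counit T) f). Qed.

Definition cofree (X : D) : Coalgebra T :=
  {| carrier := T X; coaction := comult T X;
     coaction_counit := comult_counitl T X;
     coaction_coassoc := eq_sym (comult_coassoc T X) |}.

Definition cofree_map (X Y : D) (f : hom X Y) :
    CoalgebraHom (cofree X) (cofree Y) :=
  @Build_CoalgebraHom _ _ (cofree X) (cofree Y) (fmap T f)
    (eq_sym (comult_natural f)).

Definition comult_hom (X : D) : CoalgebraHom (cofree X) (cofree (T X)) :=
  @Build_CoalgebraHom _ _ (cofree X) (cofree (T X)) (comult T X)
    (comult_coassoc T X).

Lemma separable_coseparable : separable (forgetful T) -> coseparable T.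
Proof.
intros [P [nP PK]]%separableE.
(* [P] takes values in coalgebra maps; its naturality is projected to underlying morphisms so that
   the computations take place in [D]. *)
assert (nPl : forall (A B B' : Coalgebra T) (g : CoalgebraHom B B')
    (f : hom (carrier A) (carrier B)),
  coalg_map (P A B' (g ∘ f)) = g ∘ coalg_map (P A B f)).
{ intros A B B' g f.
  exact (f_equal (@coalg_map _ _ _ _)
    (@natural_along_l _ _ (forgetful T) P A B B' g f nP)). }
assert (nPr : forall (A A' B : Coalgebra T) (f : hom (carrier A) (carrier B))
    (h : CoalgebraHom A' A),
  coalg_map (P A' B (f ∘ h)) = coalg_map (P A B f) ∘ h).
{ intros A A' B f h.
  exact (f_equal (@coalg_map _ _ _ _)
    (@natural_along_r _ _ (forgetful T) P A A' B f h nP)). }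
set (t := fun X : D => P (cofree (T X)) (cofree X) (cm_counit T (T X))).
assert (nt : forall X Y (f : hom X Y),
  coalg_map (t Y) ∘ fmap T (fmap T f) = fmap T f ∘ coalg_map (t X)).
{ intros X Y f; unfold t.
  rewrite <- (nPr _ _ _ _ (cofree_map (fmap T f))), <- (nPl _ _ _ (cofree_map f)).
  simpl; rewrite cm_counit_natural; reflexivity. }
exists (@Build_NatTrans _ _ (functor_comp T T) T
  (fun X => coalg_map (t X)) nt); simpl.
repeat split; intros X.
(* Naturality along the coalgebra map [comult T X] turns the composite into [P] of an identity. *)
- refine (eq_trans (eq_sym (nPr _ _ (cofree X) _ (comult_hom X))) _); simpl.
  rewrite comult_counitl.
  exact (f_equal (@coalg_map _ _ _ _) (PK _ _ (coalgebra_id (cofree X)))).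
(* This identity says exactly that [t X] is a coalgebra map between cofree coalgebras. *)
- exact (coalg_map_compat (t X)).
(* Both sides are values of [P], at morphisms that agree by naturality of the counit. *)
- refine (eq_trans (eq_sym (nPl (cofree (T X)) _ _ (comult_hom X) _)) _).
  refine (eq_trans _ (nPr _ _ (cofree (T X)) _ (cofree_map (comult T X)))); simpl.
  rewrite cm_counit_natural; reflexivity.
Qed.

Lemma coseparable_separable : coseparable T -> separable (forgetful T).
Proof.
intros [tau [tauK [tau_l tau_r]]]; apply separableE.
assert (ntau : forall X Y (f : hom X Y),
  tau Y ∘ fmap T (fmap T f) = fmap T f ∘ tau X) by exact (naturality tau).
set (p := fun (A B : Coalgebra T) (f : hom A B) =>
  cm_counit T B ∘ tau B ∘ fmap T (coaction B) ∘ fmap T f ∘ coaction A).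
(* The two sides of the coalgebra map condition for [p A B f] have a common value: [tau_l] and the
   right counit law give it for [hl], [tau_r] and the left counit law for [hr]. *)
assert (hl : forall (A B : Coalgebra T) (f : hom A B),
  fmap T (p A B f) ∘ coaction A =
  tau B ∘ fmap T (coaction B) ∘ fmap T f ∘ coaction A).
{ intros A B f; unfold p; rewrite !fmap_comp.
  rewrite <- (comp_assoc_eq (coaction_coassoc A)).
  rewrite <- (comp_assoc_eq (comult_natural f)).
  rewrite <- (comp_assoc_eq (comult_natural (coaction B))).
  rewrite (comp_assoc_eq (tau_l B)).
  rewrite comult_counitr, comp_idl; reflexivity. }
assert (hr : forall (A B : Coalgebra T) (f : hom A B),
  coaction B ∘ p A B f =
  tau B ∘ fmap T (coaction B) ∘ fmap T f ∘ coaction A).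
{ intros A B f; unfold p; rewrite !comp_assoc.
  rewrite <- cm_counit_natural.
  rewrite <- (comp_assoc_eq (ntau _ _ (coaction B))).
  rewrite <- (comp_assoc (_ ∘ tau _) _ (fmap T (coaction B))); simpl.
  rewrite <- fmap_comp, <- (coaction_coassoc B), fmap_comp, comp_assoc.
  rewrite <- (comp_assoc_eq (tau_r B)).
  rewrite comult_counitl, comp_idl; reflexivity. }
exists (fun A B f => @Build_CoalgebraHom _ _ A B (p A B f)
  (eq_trans (hl A B f) (eq_sym (hr A B f)))).
split.
- intros A A' B B' g f h; apply coalgebra_hom_ext; simpl; unfold p.
  rewrite !fmap_comp, !comp_assoc.
  rewrite (comp_assoc_eq (coalg_map_compat h)).
  rewrite <- (comp_assoc _ (fmap T (coaction B'))), <- fmap_comp.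
  rewrite <- (coalg_map_compat g), fmap_comp, comp_assoc.
  rewrite (comp_assoc_eq (ntau _ _ g)), cm_counit_natural; reflexivity.
(* For a coalgebra map [f] the coaction moves past [f], and coassociativity creates
   [tau B ∘ comult T B], which cancels. *)
- intros A B f; apply coalgebra_hom_ext; simpl; unfold p.
  rewrite (comp_assoc_eq (coalg_map_compat f)).
  rewrite <- (comp_assoc_eq (coaction_coassoc B)).
  rewrite (comp_assoc_idm (tauK B)), coaction_counit, comp_idl; reflexivity.
Qed.

End Coseparability.

(** * Semiseparable left adjoints and the cocomparison functor *)

Section Cocomparison.

Variables (C D : Category) (F : Functor C D) (G : Functor D C).
Variable adj : Adjunction F G.

(** By naturality and a triangle identity, [P] of the counit composed with the unit is
    [P (fmap F (idm X))], which [F] sends to an identity. *)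
Lemma semiseparable_retraction P :
  natural_along P ->
  (forall (X Y : C) (f : hom X Y), fmap F (P X Y (fmap F f)) = fmap F f) ->
  forall X : C,
    fmap F (P (G (F X)) X (adj_counit adj (F X))) ∘ fmap F (adj_unit adj X)
    = idm (F X).
Proof.
intros nP PK X.
transitivity (fmap F (P X X (fmap F (idm X)))); [|rewrite PK; apply fmap_id].
rewrite <- fmap_comp, fmap_id, <- (triangle_left adj X); f_equal.
exact (eq_sym (natural_along_r _ _ nP)).
Qed.

Lemma semiseparable_coseparable : semiseparable F -> coseparable (adj_comonad adj).
Proof.
intros [P [nP PK]]%semiseparableE.
set (nu := fun X : C => P (G (F X)) X (adj_counit adj (F X))).
assert (nu_nat : forall (X Y : C) (f : hom X Y),
  nu Y ∘ fmap G (fmap F f) = f ∘ nu X).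
{ intros X Y f; unfold nu.
  rewrite <- (natural_along_r _ _ nP), <- (natural_along_l _ _ nP).
  f_equal; exact (naturality (adj_counit adj) (fmap F f)). }
unshelve eexists.
{ refine (@Build_NatTrans _ _
    (functor_comp (adj_comonad adj) (adj_comonad adj)) (adj_comonad adj)
    (fun Y : D => fmap F (nu (G Y))) _).
  intros X Y f; simpl; rewrite <- !fmap_comp; f_equal; apply nu_nat. }
simpl; repeat split; intros Y.
(* The remaining two identities are images under [F] of naturality of the unit at [nu] and of [nu]
   at the unit. *)
- exact (semiseparable_retraction nP PK (G Y)).
- rewrite <- !fmap_comp; f_equal.
  exact (eq_sym (naturality (adj_unit adj) (nu (G Y)))).
- rewrite <- !fmap_comp; f_equal.
  exact (eq_sym (nu_nat _ _ (adj_unit adj (G Y)))).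
Qed.

Lemma semiseparable_naturally_full :
  semiseparable F -> naturally_full (cocomparison adj).
Proof.
intros [P [nP PK]]%semiseparableE; apply naturally_fullE.
exists (fun X Y
  (h : CoalgebraHom (cocomparison_ob adj X) (cocomparison_ob adj Y)) =>
    P X Y (coalg_map h)); split.
- intros X X' Y Y' g f h; exact (nP _ _ _ _ g (coalg_map f) h).
- intros X Y h; apply coalgebra_hom_ext.
  enough (main : forall h : hom (F X) (F Y),
      fmap F (fmap G h) ∘ fmap F (adj_unit adj X) = fmap F (adj_unit adj Y) ∘ h ->
      fmap F (P X Y h) = h) by exact (main (coalg_map h) (coalg_map_compat h)).
  clear h; intros h hcoalg.
  (* [k] is the adjunct of [h]. The coalgebra condition computes [fmap F k], and [P X Y h] factors
     through [k], so the retraction at [Y] leaves [h]. *)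
  set (k := fmap G h ∘ adj_unit adj X : hom X (G (F Y))).
  assert (Fk : fmap F k = fmap F (adj_unit adj Y) ∘ h)
    by exact (eq_trans (fmap_comp F _ _) hcoalg).
  assert (e : adj_counit adj (F Y) ∘ fmap F k = h).
  { rewrite Fk, comp_assoc; refine (eq_trans _ (comp_idl h)); f_equal.
    exact (triangle_left adj Y). }
  assert (Ph : P X Y h = P (G (F Y)) Y (adj_counit adj (F Y)) ∘ k)
    by exact (eq_trans (f_equal (P X Y) (eq_sym e)) (natural_along_r _ k nP)).
  rewrite Ph, fmap_comp, Fk, comp_assoc.
  refine (eq_trans _ (comp_idl h)); f_equal.
  exact (semiseparable_retraction nP PK Y).
Qed.

Lemma cocomparison_semiseparable :
  separable (forgetful (adj_comonad adj)) ->
  naturally_full (cocomparison adj) -> semiseparable F.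
Proof.
intros [P [nP PK]]%separableE [Q [nQ QK]]%naturally_fullE.
apply semiseparableE.
(* [P] makes [f] into a coalgebra map, which [Q] pulls back to [C]. *)
exists (fun X Y f => Q X Y (P (cocomparison adj X) (cocomparison adj Y) f)).
split.
- intros X X' Y Y' g f h; rewrite <- nQ; f_equal.
  exact (nP (cocomparison_ob adj X) (cocomparison_ob adj X')
    (cocomparison_ob adj Y) (cocomparison_ob adj Y')
    (cocomparison_map adj g) f (cocomparison_map adj h)).
- intros X Y f.
  generalize (QK X Y (P (cocomparison adj X) (cocomparison adj Y) (fmap F f))).
  (* [e] removes [Q]; since [fmap F f] underlies the coalgebra map [cocomparison_map adj f], [PK]
     then removes [P]. *)
  intros e; refine (eq_trans (f_equal (@coalg_map _ _ _ _) e) _).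
  exact (f_equal (@coalg_map _ _ _ _) (PK _ _ (cocomparison_map adj f))).
Qed.

End Cocomparison.

Theorem theorem2p14 (C D : Category) (F : Functor C D) (G : Functor D C)
    (adj : Adjunction F G) :
  (semiseparable F <->
     separable (forgetful (adj_comonad adj)) /\
     naturally_full (cocomparison adj)) /\
  (separable (forgetful (adj_comonad adj)) <-> coseparable (adj_comonad adj)).
Proof.
split; split.
- intros sF; split.
  + exact (coseparable_separable (semiseparable_coseparable adj sF)).
  + exact (semiseparable_naturally_full adj sF).
- intros [sU fK]; exact (cocomparison_semiseparable sU fK).
- apply separable_coseparable.
- apply coseparable_separable.
Qed.
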